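(* Let $f$ be a $C^1$ function defined on a neighborhood of a point $x_0\in\mathbb{R}$, and let $w$ be a kernel function satisfying the Normalization Constraint with parameter $W>0$ (for each $W>0$). Then the Tao Derivative of $f$ at $x_0$, $$f'_{\mathrm{TD}}(x_0;w)=\lim_{W\to 0}\frac{\int_0^W f(x_0+t)\,w(t)\,dt-\int_0^W f(x_0-t)\,w(t)\,dt}{2\int_0^W t\,w(t)\,dt},$$ exists and equals the ordinary derivative $f'(x_0)=\lim_{\Delta x\to 0}\frac{f(x_0+\Delta x)-f(x_0)}{\Delta x}$.
   Context: Normalization Constraint: for a parameter $W>0$, a (Lebesgue integrable) function $w:\mathbb{R}\to\mathbb{R}$ satisfies the Normalization Constraint with parameter $W$ if $\int_0^W w(t)\,dt=1$, $w(t)>0$ for $t\in(0,W]$, and $w(t)=0$ for $t\in(-\infty,0]\cup(W,\infty)$. The kernel $w$ depends on $W$ (one kernel for each $W>0$), and the limit $W\to 0$ in the Tao Derivative is taken over this family. *)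

(* Defs.v *)
From HB Require Import structures.
From mathcomp Require Import all_boot all_order all_algebra.
From mathcomp Require Import all_classical all_reals all_analysis.

Set Implicit Arguments.
Unset Strict Implicit.
Unset Printing Implicit Defensive.

Import Order.TTheory GRing.Theory Num.Theory.
Import numFieldNormedType.Exports.

Local Open Scope classical_set_scope.
Local Open Scope ring_scope.

(* The completed measure is used because [lebesgue_measure] only has the Borel
   sets as measurable sets; here w is an arbitrary Lebesgue integrable
   function. *)
Definition normalization_constraint (R : realType) (W : R) (w : R -> R) : Prop :=
  [/\ (@completed_lebesgue_measure R).-integrable setT (EFin \o w),
      \int[@completed_lebesgue_measure R]_(t in `[0, W]) w t = 1,
      (forall t, 0 < t <= W -> 0 < w t) &
      (forall t, t <= 0 \/ W < t -> w t = 0)].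

(* f is a total function, but only its values near x0 are constrained. *)
Definition C1_near (R : realType) (f : R -> R) (x0 : R) : Prop :=
  \forall x \near x0, derivable f x 1 /\ {for x, continuous (derive1 f)}.

Definition tao_quotient (R : realType) (f : R -> R) (w : R -> R -> R)
    (x0 W : R) : R :=
  (\int[@completed_lebesgue_measure R]_(t in `[0, W]) (f (x0 + t) * w W t)
   - \int[@completed_lebesgue_measure R]_(t in `[0, W]) (f (x0 - t) * w W t))
  / (2 * \int[@completed_lebesgue_measure R]_(t in `[0, W]) (t * w W t)).

(* Kernels exist only for W > 0, so the limit is one-sided. *)
Definition tao_derivative (R : realType) (f : R -> R) (w : R -> R -> R)
    (x0 : R) : R :=
  lim (tao_quotient f w x0 W @[W --> 0^'+]).

(* Main.v *)
(* Since f(x0 + h) - f(x0) - f'(x0) h is o(h), the difference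
   f(x0 + t) - f(x0 - t) - 2 f'(x0) t is at most 2 e t on [0, W] once W is small;
   integrating against the nonnegative weight w and dividing by 2 int t w, which
   is positive because otherwise w would vanish almost everywhere, puts the
   quotient within e of f'(x0). *)
Require Import Defs.
From HB Require Import structures.
From mathcomp Require Import all_boot all_order all_algebra.
From mathcomp Require Import all_classical all_reals all_analysis.
From mathcomp Require Import measurable_realfun lra.
Import Order.TTheory GRing.Theory Num.Theory.
Import numFieldNormedType.Exports.
Local Open Scope classical_set_scope.
Local Open Scope ring_scope.

Section weighted_quotient.
Context {d : measure_display} {T : measurableType d} {R : realType}
  (mu : {measure set T -> \bar R}) (D : set T) (mD : measurable D).

(** A zero integral of the nonnegative [h * w] would force [h * w], hence [w], to vanish almost
    everywhere, and then [w] would integrate to 0. The factor [h] may vanish at points where [w]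
    does too. *)
Lemma Rintegral_gt0 (w h : T -> R) :
  measurable_fun D w ->
  mu.-integrable D (EFin \o (fun t => h t * w t)) ->
  (forall t, D t -> 0 <= h t * w t) ->
  (forall t, D t -> h t * w t = 0 -> w t = 0) ->
  \int[mu]_(t in D) w t <> 0 ->
  0 < \int[mu]_(t in D) (h t * w t).
Proof.
move=> mw ihw hw0 hw_eq0 w_neq0.
rewrite lt_def Rintegral_ge0// andbT; apply/eqP => hw_int0; apply: w_neq0.
have int0 : (\int[mu]_(t in D) `|(h t * w t)%:E| = 0)%E.
  transitivity (\int[mu]_(t in D) (h t * w t)%:E)%E.
    by apply: eq_integral => t /set_mem Dt; rewrite gee0_abs// lee_fin hw0.
  by rewrite -(fineK (integrable_fin_num mD ihw)) -/(Rintegral _ _ _) hw_int0.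
rewrite /Rintegral (@ae_eq_integral _ _ _ mu D (cst 0%E) (EFin \o w))//.
- by rewrite integral0.
- exact/measurable_EFinP.
- have /(ae_eq_integral_abs _ mD (measurable_int _ ihw)) := int0.
  apply: filterS => t hwt Dt; congr EFin; apply: hw_eq0 => //.
  by have [] := hwt Dt.
Qed.

(** Over the common denominator, the difference has numerator the integral of
    [(g1 - g2 - 2 * c * h) * w]; the pointwise bound makes it at most [e] times that denominator. *)
Lemma dist_weighted_quotient_le (w h g1 g2 : T -> R) (c e : R) :
  mu.-integrable D (EFin \o (fun t => h t * w t)) ->
  mu.-integrable D (EFin \o (fun t => g1 t * w t)) ->
  mu.-integrable D (EFin \o (fun t => g2 t * w t)) ->
  (forall t, D t -> 0 <= w t) ->
  (forall t, D t -> `|g1 t - g2 t - 2 * c * h t| <= 2 * e * h t) ->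
  0 < \int[mu]_(t in D) (h t * w t) ->
  `|c - (\int[mu]_(t in D) (g1 t * w t) - \int[mu]_(t in D) (g2 t * w t))
        / (2 * \int[mu]_(t in D) (h t * w t))| <= e.
Proof.
move=> ih ig1 ig2 w0 gh hw_gt0.
have iZ k : mu.-integrable D (EFin \o (fun t => k * (h t * w t))).
  exact: integrableZl ih.
have iB : mu.-integrable D (EFin \o (fun t => g1 t * w t - g2 t * w t)).
  exact: integrableB ig1 ig2.
have iBZ : mu.-integrable D (EFin \o (fun t =>
    (g1 t * w t - g2 t * w t) - 2 * c * (h t * w t))).
  exact: integrableB iB (iZ (2 * c)).
set I := \int[mu]_(t in D) (h t * w t) in hw_gt0 *.
have I2_gt0 : 0 < 2 * I by rewrite mulr_gt0.
(* Write [c] as [c * (2 * I) / (2 * I)] and clear the positive denominator. *)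
rewrite distrC -[c in _ - c](mulfK (lt0r_neq0 I2_gt0)) -mulrBl normrM.
rewrite [`|_^-1|]gtr0_norm ?invr_gt0// ler_pdivrMr//.
rewrite -RintegralB// (_ : c * _ = \int[mu]_(t in D) (2 * c * (h t * w t)));
  last by rewrite RintegralZl//; rewrite mulrCA mulrA.
rewrite -RintegralB//.
apply: (le_trans (le_normr_Rintegral mD iBZ)).
rewrite [leRHS](_ : _ = \int[mu]_(t in D) (2 * e * (h t * w t))); last first.
  by rewrite RintegralZl//; rewrite mulrCA mulrA.
apply: le_Rintegral => //; first exact: integrable_norm iBZ.
move=> t Dt; rewrite !(mulrA _ (h t)) -!mulrBl normrM (ger0_norm (w0 _ Dt)).
by rewrite ler_wpM2r ?w0 ?gh.
Qed.

End weighted_quotient.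

Section completed_measure.
Context {R : realType}.
Notation mu := (@completed_lebesgue_measure R).

Lemma measurable_completed (A : set R) : measurable A ->
  (wlength idfun)^*%mu.-cara.-measurable A.
Proof. exact: sub_caratheodory. Qed.

(** On the compact segment [g] is bounded and measurable, and such a factor preserves
    integrability. *)
Lemma integrable_continuousM (g w : R -> R) (a b : R) :
  {in `[a, b]%R, forall t, {for t, continuous g}} ->
  mu.-integrable setT (EFin \o w) ->
  mu.-integrable `[a, b] (EFin \o (fun t => g t * w t)).
Proof.
move=> cg iw.
have cgs : {within `[a, b], continuous g}.
  by apply: continuous_in_subspaceT => t /set_mem; exact: cg.
have mD := measurable_completed _ (measurable_itv `[a, b]).
apply: (integrableMr mD _ _ (integrableS measurableT mD _ iw)) => //.
(* Preimages under [g] are Borel by continuity, so they are measurable for the completed measure. *)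
- move=> _ Y mY; apply: measurable_completed.
  apply: (subspace_continuous_measurable_fun (measurable_itv `[a, b]) cgs) => //.
- have := compact_bounded (continuous_compact cgs (@segment_compact _ a b)).
  rewrite /bounded_set /bounded_near.
  by apply: filterS => M /= gM t Dt; apply: gM; exists t.
Qed.

End completed_measure.

(** This is the difference quotient estimate multiplied by [h]. The limit only sees [h != 0]; at
    [h = 0] both sides are 0. *)
Lemma derivable_affine_approx {R : realType} (f : R -> R) (x e : R) :
  derivable f x 1 -> 0 < e ->
  \forall h \near 0, `|f (x + h) - f x - derive1 f x * h| <= e * `|h|.
Proof.
move=> df e_gt0.
have /cvgrPdist_le/(_ e e_gt0) := df.
rewrite near_withinE; apply: filterS => h.
have [->|h_neq0] := eqVneq h 0.
  by rewrite addr0 subrr mulr0 subrr !normr0 mulr0.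
move=> /(_ isT); rewrite [h%:A]mulr1 /= [h + x]addrC.
rewrite -[lim _]/(derive f x 1) -derive1E distrC => fh.
rewrite (_ : _ - _ = (h^-1 *: (f (x + h) - f x) - derive1 f x) * h).
  by rewrite normrM ler_wpM2r.
by rewrite mulrBl [_ *: _]mulrC mulfVK.
Qed.

Theorem theorem1 (R : realType) (f : R -> R) (x0 : R) (w : R -> R -> R)
    (hf : C1_near f x0)
    (hw : forall W : R, 0 < W -> normalization_constraint W (w W)) :
  cvg (tao_quotient f w x0 W @[W --> 0^'+]) /\
  tao_derivative f w x0 = derive1 f x0.
Proof.
suff cvgTD : tao_quotient f w x0 W @[W --> 0^'+] --> derive1 f x0.
  split; first exact: cvgP cvgTD.
  exact: cvg_lim cvgTD.
have df0 : derivable f x0 1 by have [] := nbhs_singleton hf.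
apply/cvgrPdist_le => e e_gt0.
have /nbhs_ballP[/= r r_gt0 approx] := derivable_affine_approx _ _ _ df0 e_gt0.
have /nbhs_ballP[/= s s_gt0 dfs] := hf.
near=> W.
have W_gt0 : 0 < W by [].
(* Below [r] the affine approximation at [x0] applies; below [s] the function is derivable, hence
   continuous, at every [x0 + u] with [|u| <= W]. *)
have W_lt : W < Num.min r s.
  by near: W; apply: nbhs_right_lt; rewrite lt_min r_gt0.
have [W_r W_s] : W < r /\ W < s by apply/andP; rewrite -lt_min.
have [iw w1 w_gt0 w_eq0] := hw W W_gt0.
have cf u : `|u| <= W -> {for (x0 + u), continuous f}.
  move=> uW; apply/differentiable_continuous/derivable1_diffP.
  apply: (dfs _ _).1; rewrite /ball/= opprD addNKr normrN.
  exact: le_lt_trans W_s.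
have it : (@completed_lebesgue_measure R).-integrable `[0, W]
    (EFin \o (fun t => t * w W t)).
  by apply: (integrable_continuousM id) iw => t _.
have nonneg t : 0 <= t <= W -> 0 <= w W t.
  move=> /andP[]; rewrite le_eqVlt => /predU1P[<- _|t0 tW].
    by rewrite w_eq0//; left.
  by rewrite ltW// w_gt0// t0.
have mD := measurable_completed _ (measurable_itv `[0, W]).
(* Here [h] is the identity, and [g1], [g2] are [f (x0 + t)], [f (x0 - t)]. *)
rewrite /tao_quotient; apply: dist_weighted_quotient_le => //.
- apply: (integrable_continuousM (fun t => f (x0 + t))) iw => t.
  rewrite in_itv/= => /andP[t0 tW].
  apply: continuous_comp; first by apply: cvgD; [exact: cvg_cst|exact: cvg_id].
  by apply: cf; rewrite ger0_norm.
- apply: (integrable_continuousM (fun t => f (x0 - t))) iw => t.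
  rewrite in_itv/= => /andP[t0 tW].
  apply: continuous_comp.
    by apply: cvgD; [exact: cvg_cst|apply: cvgN; exact: cvg_id].
  by apply: cf; rewrite normrN ger0_norm.
- move=> /= t; rewrite in_itv/= => /andP[t0 tW].
  have tr : `|t| < r by rewrite ger0_norm// (le_lt_trans tW).
  have := approx t; rewrite /ball/= sub0r normrN => /(_ tr) fp.
  have := approx (- t); rewrite /ball/= sub0r opprK => /(_ tr).
  rewrite normrN => fm.
  (* The symmetric difference splits into the affine remainders at [t] and [- t]: the terms [f x0]
     cancel, and each remainder is at most [e * t]. *)
  rewrite (_ : _ - _ = (f (x0 + t) - f x0 - derive1 f x0 * t)
                     - (f (x0 - t) - f x0 - derive1 f x0 * (- t))); last by lra.
  apply: le_trans (ler_normB _ _) _.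
  by rewrite (le_trans (lerD fp fm))// ger0_norm//; lra.
- apply: Rintegral_gt0 => //.
  + apply/measurable_EFinP.
    exact: measurable_int (integrableS measurableT mD _ iw).
  + move=> /= t; rewrite in_itv/= => /andP[t0 tW].
    by rewrite mulr_ge0// nonneg// t0.
  (* The factor [t] vanishes only at the endpoint 0, where the kernel is 0 by the constraint. *)
  + move=> t _ /eqP; rewrite mulf_eq0 => /predU1P[->|/eqP//].
    by rewrite w_eq0//; left.
  + by rewrite w1; exact/eqP/oner_neq0.
Unshelve. all: by end_near.
Qed.
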